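(* Let $d\ge2$. The duality map $f\mapsto f^*$ on the set of continuous antinorms on $\mathbb{R}^d_+$, equipped with the distance $\|f_1-f_2\|=\max_{\boldsymbol{x}\in\Delta}|f_1(\boldsymbol{x})-f_2(\boldsymbol{x})|$, where $\Delta=\{\boldsymbol{x}\in\mathbb{R}^d_+ : \sum_{i=1}^d x_i=1\}$, is discontinuous.
   Context: $\mathbb{R}^d_+$ is the set of points of $\mathbb{R}^d$ with all coordinates nonnegative. An antinorm on $\mathbb{R}^d_+$ is a nonnegative, somewhere positive, concave, homogeneous functional $f:\mathbb{R}^d_+\to[0,+\infty)$, where homogeneous means $f(\lambda\boldsymbol{x})=\lambda f(\boldsymbol{x})$ for all $\lambda\ge0$. The dual of an antinorm $f$ is the antinorm $$f^*(\boldsymbol{p})=\inf_{\boldsymbol{x}\in\mathbb{R}^d_+,\ f(\boldsymbol{x})\ne0}\frac{(\boldsymbol{p},\boldsymbol{x})}{f(\boldsymbol{x})},\qquad \boldsymbol{p}\in\mathbb{R}^d_+,$$ where $(\cdot,\cdot)$ is the standard inner product; the dual of a continuous antinorm is again a continuous antinorm. *)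

(* Defs.v *)
From HB Require Import structures.
From mathcomp Require Import all_boot all_order all_algebra.
From mathcomp Require Import ring lra.
From mathcomp Require Import all_classical all_reals all_analysis.

Set Implicit Arguments.
Unset Strict Implicit.
Unset Printing Implicit Defensive.

Import Order.TTheory GRing.Theory Num.Theory.
Import numFieldTopology.Exports numFieldNormedType.Exports.

Local Open Scope classical_set_scope.
Local Open Scope ring_scope.

Section antinorms.
Context {R : realType} {d : nat}.
Implicit Types (p q x y : 'rV[R]_d) (f g : 'rV[R]_d -> R).

Definition dotr p x : R := \sum_i p ord0 i * x ord0 i.

Definition orthant : set 'rV[R]_d := [set x | forall i, 0 <= x ord0 i].

Definition simplex : set 'rV[R]_d :=
  [set x | orthant x /\ \sum_i x ord0 i = 1].

Definition concave_function (D : set (convex_lmodType 'rV[R]_d)) f : Prop :=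
  convex_function D (fun x => - f x).

(* A function on the orthant is represented by a function on the whole space;
   only its values on the orthant matter here. *)
Record is_antinorm f : Prop := IsAntinorm {
  antinorm_ge0 : forall x, orthant x -> 0 <= f x ;
  antinorm_pos : exists2 x, orthant x & 0 < f x ;
  antinorm_concave : concave_function orthant f ;
  antinormZ : forall a x, 0 <= a -> orthant x -> f (a *: x) = a * f x }.

(* The infimum is the genuine one whenever f is an antinorm and p is in the
   orthant: the set is then nonempty and bounded below by 0. *)
Definition dual_fun f p : R :=
  if p \in orthant then
    inf [set dotr p x / f x | x in [set x | orthant x /\ f x != 0]]
  else 0.

Lemma concave_functionP f :
  concave_function orthant f <->
  forall t x y, 0 <= t <= 1 -> orthant x -> orthant y ->
    t * f x + (1 - t) * f y <= f (t *: x + (1 - t) *: y).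
Proof.
split=> [cf t x y t01 ox oy|cf t x y].
  case/andP: t01 => t0 t1.
  have := cf (Itv01 t0 t1) x y (mem_set ox) (mem_set oy).
  rewrite !convRE/= /conv/= => h.
  suff : t * - f x + (1 - t) * - f y >= - f (t *: x + (1 - t) *: y).
    by rewrite !mulrN -opprD lerN2.
  exact: h.
rewrite !inE => ox oy.
have t01 : 0 <= t%:num <= 1 by apply/andP; split.
have := cf t%:num x y t01 ox oy => h.
rewrite convRE/= /conv/=.
suff : t%:num * - f x + (1 - t%:num) * - f y
     >= - f (t%:num *: x + (1 - t%:num) *: y) by [].
by rewrite !mulrN -opprD lerN2.
Qed.

Lemma orthantZ a x : 0 <= a -> orthant x -> orthant (a *: x).
Proof. by move=> a0 ox i; rewrite mxE mulr_ge0. Qed.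

Lemma orthantD x y : orthant x -> orthant y -> orthant (x + y).
Proof. by move=> ox oy i; rewrite mxE addr_ge0. Qed.

Lemma orthant0 : orthant 0.
Proof. by move=> i; rewrite mxE. Qed.

Lemma dotrDl p q x : dotr (p + q) x = dotr p x + dotr q x.
Proof.
by rewrite /dotr -big_split; apply: eq_bigr => i _; rewrite mxE mulrDl.
Qed.

Lemma dotrZl a p x : dotr (a *: p) x = a * dotr p x.
Proof. by rewrite /dotr mulr_sumr; apply: eq_bigr => i _; rewrite mxE mulrA. Qed.

Lemma dotr_ge0 p x : orthant p -> orthant x -> 0 <= dotr p x.
Proof. by move=> op ox; apply: sumr_ge0 => i _; rewrite mulr_ge0. Qed.

Lemma dotr_continuous x : continuous (fun p => dotr p x).
Proof.
apply: (continuous_big (@add_continuous R)) => i _.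
have H : continuous (fun p : 'rV[R]_d => p ord0 i) by exact: coord_continuous.
by move=> p; exact: (cvgM (H p) (cvg_cst (x ord0 i))).
Qed.

Section theory.
Variable f : 'rV[R]_d -> R.
Hypothesis fA : is_antinorm f.

Lemma antinorm0 : f 0 = 0.
Proof.
rewrite -[0 in LHS](scale0r (0 : 'rV[R]_d)).
by rewrite (antinormZ fA) ?mul0r//; exact: orthant0.
Qed.

Lemma antinormD x y : orthant x -> orthant y -> f x + f y <= f (x + y).
Proof.
move=> ox oy.
have h01 : 0 <= (2^-1 : R) <= 1 by apply/andP; split; lra.
have := (concave_functionP f).1 (antinorm_concave fA) _ _ _ h01 ox oy.
have -> : 1 - 2^-1 = 2^-1 :> R by lra.
have h0 : 0 <= (2^-1 : R) by lra.
have := antinormZ fA h0 (orthantD ox oy).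
rewrite scalerDr => ->; lra.
Qed.

Lemma antinorm_le x y : orthant x -> orthant y -> f x <= f (x + y).
Proof.
move=> ox oy; apply: le_trans (antinormD ox oy).
by rewrite lerDl (antinorm_ge0 fA).
Qed.

Lemma orthant_simplex x : orthant x -> x != 0 ->
  exists2 a, 0 < a & simplex (a^-1 *: x).
Proof.
move=> ox x0; exists (\sum_i x ord0 i).
  rewrite lt_neqAle sumr_ge0 ?andbT; last by move=> i _; exact: ox.
  apply: contra x0 => /eqP s0; apply/eqP/rowP => i; rewrite mxE.
  move/esym/eqP: s0; rewrite psumr_eq0; last by move=> j _; exact: ox.
  by move=> /allP/(_ i); rewrite mem_index_enum => /(_ isT)/eqP.
set s := \sum_i x ord0 i.
have s0 : s != 0.
  apply: contra x0 => /eqP s0; apply/eqP/rowP => i; rewrite mxE.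
  move/eqP: s0; rewrite psumr_eq0; last by move=> j _; exact: ox.
  by move=> /allP/(_ i); rewrite mem_index_enum => /(_ isT)/eqP.
split.
  by apply: orthantZ => //; rewrite invr_ge0; apply: sumr_ge0 => i _; exact: ox.
under eq_bigr do rewrite mxE.
by rewrite -mulr_sumr mulVf.
Qed.

Lemma simplex_nonempty : simplex !=set0.
Proof.
have [x ox fx] := antinorm_pos fA.
have x0 : x != 0 by apply: contraTneq fx => ->; rewrite antinorm0 ltxx.
by have [a _ sx] := orthant_simplex ox x0; exists (a^-1 *: x).
Qed.

Lemma dual_fun_le p x : orthant p -> orthant x -> f x != 0 ->
  dual_fun f p <= dotr p x / f x.
Proof.
move=> op ox fx; rewrite /dual_fun mem_set//; apply: ge_inf; last by exists x.
exists 0 => _ [y [oy fy] <-].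
by rewrite divr_ge0 ?dotr_ge0// (antinorm_ge0 fA).
Qed.

Lemma le_dual_fun p c : orthant p ->
  (forall x, orthant x -> 0 < f x -> c <= dotr p x / f x) -> c <= dual_fun f p.
Proof.
move=> op h; rewrite /dual_fun mem_set//; apply: lb_le_inf.
  have [x ox fx] := antinorm_pos fA.
  by exists (dotr p x / f x), x => //; split; rewrite ?gt_eqF.
move=> _ [y [oy fy] <-]; apply: h => //.
by rewrite lt_neqAle eq_sym fy (antinorm_ge0 fA).
Qed.

Lemma dual_fun_ge0 p : orthant p -> 0 <= dual_fun f p.
Proof.
move=> op; apply: le_dual_fun => // x ox fx.
by rewrite divr_ge0 ?dotr_ge0// ltW.
Qed.

Lemma dual_fun_adherent p e : orthant p -> 0 < e ->
  exists x, [/\ orthant x, 0 < f x & dotr p x / f x < dual_fun f p + e].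
Proof.
move=> op e0; apply: contrapT => h.
suff : dual_fun f p + e <= dual_fun f p by rewrite gerDl leNgt e0.
apply: le_dual_fun => // x ox fx; rewrite leNgt; apply/negP => hx.
by apply: h; exists x.
Qed.

Lemma dual_fun_mono p q : orthant p -> orthant q ->
  (forall i, p ord0 i <= q ord0 i) -> dual_fun f p <= dual_fun f q.
Proof.
move=> op oq pq; apply: le_dual_fun => // x ox fx.
apply: (le_trans (dual_fun_le op ox _)); first by rewrite gt_eqF.
rewrite ler_pM2r ?invr_gt0//; apply: ler_sum => i _.
by rewrite ler_wpM2r.
Qed.

Lemma dual_funZ a p : 0 <= a -> orthant p ->
  dual_fun f (a *: p) = a * dual_fun f p.
Proof.
have H b q : 0 <= b -> orthant q -> b * dual_fun f q <= dual_fun f (b *: q).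
  move=> b0 oq; apply: le_dual_fun; first exact: orthantZ.
  move=> x ox fx; rewrite dotrZl -mulrA ler_wpM2l//.
  by apply: dual_fun_le => //; rewrite gt_eqF.
move=> a0 op; apply/eqP; rewrite eq_le H// andbT.
have [->|an0] := eqVneq a 0.
  have [x ox fx] := antinorm_pos fA.
  rewrite mul0r; have /le_trans : dual_fun f (0 *: p) <= dotr (0 *: p) x / f x.
    by apply: dual_fun_le; rewrite ?gt_eqF//; exact: orthantZ.
  by apply; rewrite dotrZl !mul0r.
have := @H a^-1 (a *: p); rewrite invr_ge0 => /(_ a0 (orthantZ a0 op)).
rewrite scalerA mulVf// scale1r.
by rewrite -[X in _ -> X <= _](mulVKf an0) => /(ler_wpM2l a0).
Qed.

Lemma dual_fun_antinorm : is_antinorm (dual_fun f).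
Proof.
split.
- exact: dual_fun_ge0.
- pose u : 'rV[R]_d := const_mx 1.
  have ou : orthant u by move=> i; rewrite mxE.
  have le_fu x : orthant x -> f x <= (\sum_i x ord0 i) * f u.
    move=> ox; rewrite -(antinormZ fA)//; last by apply: sumr_ge0 => i _; exact: ox.
    rewrite -[X in _ <= f X](subrKC x); apply: antinorm_le => // i.
    rewrite !mxE mulr1 subr_ge0 (bigD1 i)//= lerDl.
    by apply: sumr_ge0 => j _; exact: ox.
  have fu0 : 0 < f u.
    have [x ox fx] := antinorm_pos fA; have := lt_le_trans fx (le_fu x ox).
    rewrite lt0r mulf_eq0 negb_or => /andP[/andP[_ fu] _].
    by rewrite lt_neqAle eq_sym fu (antinorm_ge0 fA).
  exists u => //; apply: (@lt_le_trans _ _ (f u)^-1); first by rewrite invr_gt0.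
  apply: le_dual_fun => // x ox fx.
  rewrite ler_pdivlMr// ler_pdivrMl// mulrC.
  have -> : dotr u x = \sum_i x ord0 i.
    by apply: eq_bigr => i _; rewrite mxE mul1r.
  exact: le_fu.
- apply/concave_functionP => t p q /andP[t0 t1] op oq.
  have t1' : 0 <= 1 - t by rewrite subr_ge0.
  apply: le_dual_fun; first by apply: orthantD; exact: orthantZ.
  move=> x ox fx; rewrite dotrDl !dotrZl [leRHS]mulrDl -2!mulrA.
  by rewrite lerD// ler_wpM2l// dual_fun_le// gt_eqF.
- by move=> a x a0 ox; exact: dual_funZ.
Qed.

Lemma dual_fun_continuous : {within orthant, continuous (dual_fun f)}.
Proof.
apply/subspace_continuousP => p op; apply/cvgrPdist_lt => e e0.
have [x [ox fx hx]] := dual_fun_adherent op e0.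
have fp0 := dual_fun_ge0 op.
pose del := e / (dual_fun f p + e).
have den0 : 0 < dual_fun f p + e by lra.
have del0 : 0 < del by rewrite divr_gt0.
have del1 : del <= 1 by rewrite ler_pdivrMr// mul1r; lra.
have delp : del * dual_fun f p < e.
  by rewrite /del mulrAC ltr_pdivrMr// ltr_pM2l//; lra.
have near1 : \forall q \near p, dotr q x / f x < dual_fun f p + e.
  have /cvgr_lt : (fun q => dotr q x / f x) @ p --> dotr p x / f x.
    exact: (cvgM (@dotr_continuous x p) (cvg_cst (f x)^-1)).
  exact.
have near2 : \forall q \near p,
    forall i, 0 < p ord0 i -> (1 - del) * p ord0 i < (q : 'rV[R]_d) ord0 i.
  suff H i : \forall q \near p,
      0 < p ord0 i -> (1 - del) * p ord0 i < (q : 'rV[R]_d) ord0 i.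
    exact: (@filter_forall _ _ (fun i (q : 'rV[R]_d) =>
      0 < p ord0 i -> (1 - del) * p ord0 i < q ord0 i) (nbhs p) _ H).
  have [p0|p0] := ltP 0 (p ord0 i); last by apply: filterE.
  have lt_p : (1 - del) * p ord0 i < p ord0 i by nra.
  have /cvgr_gt/(_ _ lt_p) := @coord_continuous R 1 d ord0 i p.
  by apply: filterS => q + _.
have d1 : 0 <= 1 - del by rewrite subr_ge0.
rewrite near_withinE; near=> q => oq.
rewrite ltr_distlC; apply/andP; split; last first.
  apply: le_lt_trans (_ : dotr q x / f x < _).
    by apply: dual_fun_le => //; rewrite gt_eqF.
  by near: q.
apply: (@lt_le_trans _ _ (dual_fun f ((1 - del) *: p))).
  by rewrite dual_funZ// mulrBl mul1r ltrD2l ltrN2.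
have dp : orthant ((1 - del) *: p) by exact: orthantZ.
apply: dual_fun_mono => // i; rewrite mxE.
have [p0|p0] := ltP 0 (p ord0 i).
  by apply: ltW; move: p0; move: i; near: q.
have -> : p ord0 i = 0 by apply/eqP; rewrite eq_le p0 op.
by rewrite mulr0.
Unshelve. all: by end_near.
Qed.

End theory.

Lemma simplex_compact : compact simplex.
Proof.
have K := @rV_compact R d (fun=> `[0, 1]%classic) (fun=> @segment_compact R 0 1).
apply: (subclosed_compact _ K).
  have -> : simplex = (\bigcap_(i in [set: 'I_d])
      ((fun v : 'rV[R]_d => v ord0 i) @^-1` [set t | 0 <= t])) `&`
      ((fun v : 'rV[R]_d => \sum_i v ord0 i) @^-1` [set 1]).
    apply/seteqP; split => [x [ox sx]|x [ox sx]].
      by split => // i _; exact: ox.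
    by split => // i; exact: ox.
  apply: closedI.
    apply: closed_bigI => i _; apply: preimage_closed; last exact: closed_ge.
    by move=> v _; exact: coord_continuous.
  apply: preimage_closed; last exact: closed_eq.
  move=> v _; move: v; apply: (continuous_big (@add_continuous R)) => i _.
  exact: coord_continuous.
move=> x [ox sx] i /=; rewrite in_itv/= ox -sx (bigD1 i)//= lerDl.
by apply: sumr_ge0 => j _; exact: ox.
Qed.

End antinorms.

Section cantinorm_type.
Variables (R : realType) (d : nat).

(* Setting the representing function to 0 outside the orthant makes equality
   in this type coincide with equality of functions on the orthant. *)
Record cantinorm := CAntinorm {
  cantinorm_fun :> 'rV[R]_d -> R ;
  cantinormP : is_antinorm cantinorm_fun ;
  cantinorm_continuous : {within orthant, continuous cantinorm_fun} ;
  cantinorm_out : forall x, ~ orthant x -> cantinorm_fun x = 0 }.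

HB.instance Definition _ := gen_eqMixin cantinorm.
HB.instance Definition _ := gen_choiceMixin cantinorm.

Implicit Types f g h : cantinorm.

Lemma cantinorm_inj f g : cantinorm_fun f = cantinorm_fun g -> f = g.
Proof.
case: f g => [f f1 f2 f3] [g g1 g2 g3] /= fg.
by subst g; congr CAntinorm; exact: Prop_irrelevance.
Qed.

Definition cantinorm_dist f g : R :=
  sup [set `|f x - g x| | x in simplex].

Lemma cantinorm_dist_max f g : exists2 x, simplex x &
  cantinorm_dist f g = `|f x - g x| /\
  forall y, simplex y -> `|f y - g y| <= `|f x - g x|.
Proof.
have sub : simplex `<=` @orthant R d by move=> x [].
have cont : {within simplex, continuous (fun x => `|f x - g x|)}.
  move=> x; apply: cvg_norm; apply: cvgB.
    exact: (continuous_subspaceW sub (@cantinorm_continuous f)).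
  exact: (continuous_subspaceW sub (@cantinorm_continuous g)).
have [x sx xmax] := compact_EVT_max (simplex_nonempty (cantinormP f))
  simplex_compact cont.
have {}xmax y : simplex y -> `|f y - g y| <= `|f x - g x|.
  by move=> sy; apply: xmax; exact: mem_set.
move/set_mem in sx.
exists x => //; split=> //; apply/eqP; rewrite eq_le; apply/andP; split.
  by apply: ge_sup; [exists `|f x - g x|, x|move=> _ [y sy <-]; exact: xmax].
apply: ub_le_sup; last by exists x.
by exists `|f x - g x| => _ [y sy <-]; exact: xmax.
Qed.

Lemma le_cantinorm_dist f g x : simplex x -> `|f x - g x| <= cantinorm_dist f g.
Proof. by move=> sx; have [y _ [-> ]] := cantinorm_dist_max f g; exact. Qed.

Lemma cantinorm_distxx f : cantinorm_dist f f = 0.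
Proof. by have [x _ [-> _]] := cantinorm_dist_max f f; rewrite subrr normr0. Qed.

Lemma cantinorm_dist_positivity f g : cantinorm_dist f g = 0 -> f = g.
Proof.
move=> fg0; apply: cantinorm_inj; apply/funext => x.
have [ox|ox] := pselect (orthant x); last by rewrite !cantinorm_out.
have [->|x0] := eqVneq x 0; first by rewrite !antinorm0//; exact: cantinormP.
have [a a0 sx] := orthant_simplex ox x0.
have : f (a^-1 *: x) = g (a^-1 *: x).
  apply/eqP; rewrite -subr_eq0 -normr_le0 -fg0; exact: le_cantinorm_dist.
have a0' : 0 <= a^-1 by rewrite invr_ge0 ltW.
rewrite (antinormZ (cantinormP f))// (antinormZ (cantinormP g))//.
have an0 : a^-1 != 0 by rewrite invr_eq0 gt_eqF.
by move/(mulfI an0).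
Qed.

Lemma cantinorm_dist_sym f g : cantinorm_dist f g = cantinorm_dist g f.
Proof.
by congr sup; apply/seteqP; split => _ [x sx <-]; exists x => //; rewrite distrC.
Qed.

Lemma cantinorm_dist_triangle g f h :
  cantinorm_dist f h <= cantinorm_dist f g + cantinorm_dist g h.
Proof.
have [x sx [-> _]] := cantinorm_dist_max f h.
apply: (le_trans (ler_distD (g x) _ _)).
by rewrite lerD// le_cantinorm_dist.
Qed.

HB.instance Definition _ := isMetric.Build R cantinorm
  cantinorm_distxx cantinorm_dist_positivity cantinorm_dist_sym
  cantinorm_dist_triangle.

Lemma cantinorm_ballE f e : ball f e = [set g | cantinorm_dist f g < e].
Proof. by []. Qed.

Lemma dual_fun_out f x : ~ orthant x -> dual_fun f x = 0.
Proof. by move=> ox; rewrite /dual_fun memNset. Qed.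

Definition dual f : cantinorm :=
  CAntinorm (dual_fun_antinorm (cantinormP f))
    (dual_fun_continuous (cantinormP f)) (@dual_fun_out f).

End cantinorm_type.

(* Main.v *)
Require Import Defs.
From mathcomp Require Import all_boot all_order all_algebra.
From mathcomp Require Import lra.
From mathcomp Require Import all_classical all_reals all_analysis.

(** Duality is sensitive to the zeros of an antinorm on the boundary of the
    orthant: a point [x] enters the infimum defining [f^*] as soon as
    [f x != 0], however small [f x] is.  With [e_0], [e_1], ... the standard
    basis, consider the linear antinorms [f x = (e_0, x)] and
    [g x = (e_0 + a e_1, x)] for a small [a > 0].  Their distance is at most
    [a].  Yet [f^*(e_0) = 1], every quotient being [1], whereas
    [g^*(e_0) = 0]: the point [e_1] is orthogonal to [e_0] and
    [g e_1 = a != 0].  Thus [f^*] and [g^*] stay at distance at least [1] as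
    [a] tends to [0], and duality is discontinuous at [f]. *)

Set Implicit Arguments.
Unset Strict Implicit.
Unset Printing Implicit Defensive.

Import Order.TTheory GRing.Theory Num.Theory.
Import numFieldTopology.Exports numFieldNormedType.Exports.

Local Open Scope classical_set_scope.
Local Open Scope ring_scope.

Section linear_antinorm.
Context {R : realType} {d : nat}.
Implicit Types (c p x y : 'rV[R]_d) (i : 'I_d).

Lemma dotrC p x : dotr p x = dotr x p.
Proof. by apply: eq_bigr => i _; rewrite mulrC. Qed.

Lemma dotr_deltal i x : dotr (delta_mx ord0 i) x = x ord0 i.
Proof.
rewrite /dotr (bigD1 i)//= mxE !eqxx mul1r big1 ?addr0// => j ji.
by rewrite mxE (negPf ji) andbF mul0r.
Qed.

Lemma orthant_delta i : orthant (delta_mx ord0 i : 'rV[R]_d).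
Proof. by move=> j; rewrite mxE ler0n. Qed.

Lemma simplex_delta i : simplex (delta_mx ord0 i : 'rV[R]_d).
Proof.
split; first exact: orthant_delta.
rewrite (bigD1 i)//= mxE !eqxx big1 ?addr0// => j ji.
by rewrite mxE (negPf ji) andbF.
Qed.

Lemma simplex_coord_le1 x i : simplex x -> x ord0 i <= 1.
Proof.
move=> [ox <-]; rewrite (bigD1 i)//= lerDl.
by apply: sumr_ge0 => j _; exact: ox.
Qed.

(** Truncated to [0] outside the orthant, as the type of continuous antinorms
    requires. *)
Definition linear_fun c x : R := if x \in orthant then dotr c x else 0.

Lemma linear_funE c x : orthant x -> linear_fun c x = dotr c x.
Proof. by move=> ox; rewrite /linear_fun mem_set. Qed.

Lemma linear_fun_out c x : ~ orthant x -> linear_fun c x = 0.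
Proof. by move=> ox; rewrite /linear_fun memNset. Qed.

Lemma linear_fun_antinorm c : orthant c -> c != 0 ->
  is_antinorm (linear_fun c).
Proof.
move=> oc c0; split.
- by move=> x ox; rewrite linear_funE// dotr_ge0.
- have [i ci] : exists i, c ord0 i != 0.
    by apply/existsP; apply: contraR c0 => /existsPn h; apply/eqP/rowP => i;
       rewrite mxE; apply/eqP; have := h i; rewrite negbK.
  exists (delta_mx ord0 i); first exact: orthant_delta.
  rewrite linear_funE; last exact: orthant_delta.
  by rewrite dotrC dotr_deltal lt0r ci oc.
- apply/concave_functionP => t x y /andP[t0 t1] ox oy.
  have ox' : orthant (t *: x) by exact: orthantZ.
  have oy' : orthant ((1 - t) *: y) by apply: orthantZ; rewrite ?subr_ge0.
  rewrite !linear_funE//; last exact: orthantD.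
  by rewrite !(dotrC c) dotrDl !dotrZl.
- move=> a x a0 ox; rewrite !linear_funE//; last exact: orthantZ.
  by rewrite !(dotrC c) dotrZl.
Qed.

Lemma linear_fun_continuous c : {within orthant, continuous (linear_fun c)}.
Proof.
apply: (@subspace_eq_continuous _ _ _ (fun x => dotr x c)).
  by move=> x /set_mem ox; rewrite -[RHS]/(linear_fun c x) linear_funE// dotrC.
exact/continuous_subspaceT/dotr_continuous.
Qed.

Definition linear_cantinorm c (oc : orthant c) (c0 : c != 0) : cantinorm R d :=
  CAntinorm (linear_fun_antinorm oc c0) (@linear_fun_continuous c)
    (@linear_fun_out c).

Lemma dual_linear_fun_ge1 c : orthant c -> c != 0 ->
  1 <= dual_fun (linear_fun c) c.
Proof.
move=> oc c0; apply: le_dual_fun => //; first exact: linear_fun_antinorm.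
by move=> x ox; rewrite linear_funE// => cx; rewrite divff// gt_eqF.
Qed.

(** The source of the discontinuity: positivity of [f] at a point orthogonal
    to [p], whatever its size, forces the dual to vanish at [p]. *)
Lemma dual_fun_orthogonal (f : 'rV[R]_d -> R) p x : is_antinorm f ->
  orthant p -> orthant x -> dotr p x = 0 -> f x != 0 -> dual_fun f p = 0.
Proof.
move=> fA op ox px fx; apply/eqP; rewrite eq_le dual_fun_ge0// andbT.
by apply: (le_trans (dual_fun_le fA op ox fx)); rewrite px mul0r.
Qed.

End linear_antinorm.

Theorem theorem3 (R : realType) (d : nat) (hd : (2 <= d)%N) :
  ~ continuous (@dual R d).
Proof.
pose i0 : 'I_d := Ordinal (ltnW hd); pose i1 : 'I_d := Ordinal hd.
pose e0 : 'rV[R]_d := delta_mx ord0 i0; pose e1 : 'rV[R]_d := delta_mx ord0 i1.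
have oe0 : orthant e0 := orthant_delta i0.
have oe1 : orthant e1 := orthant_delta i1.
have e0i0 : e0 ord0 i0 = 1 by rewrite mxE !eqxx.
have e1i0 : e1 ord0 i0 = 0 by rewrite mxE.
have e1i1 : e1 ord0 i1 = 1 by rewrite mxE !eqxx.
have e0_neq0 : e0 != 0.
  by apply/eqP => /rowP/(_ i0); rewrite e0i0 mxE => /eqP; rewrite oner_eq0.
pose f := linear_cantinorm oe0 e0_neq0.
move=> /(_ f) /(_ _ (nbhsx_ballx (dual f) 1 ltr01)).
move=> /nbhs_ballP[e /= e_gt0 ball_e].
pose a := e / 2; have a_gt0 : 0 < a by rewrite divr_gt0.
have oc : orthant (e0 + a *: e1) by apply: orthantD => //; apply/orthantZ/oe1/ltW.
have c_neq0 : e0 + a *: e1 != 0.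
  apply/eqP => /rowP/(_ i0); rewrite !mxE /= mulr0 addr0 => /eqP.
  by rewrite oner_eq0.
pose g := linear_cantinorm oc c_neq0.
have fg : ball f e g.
  rewrite cantinorm_ballE /=.
  have [x sx [-> _]] := cantinorm_dist_max f g.
  have ox : orthant x by case: sx.
  rewrite /= !linear_funE// dotrDl dotrZl !dotr_deltal.
  rewrite opprD addNKr normrN ger0_norm; last exact: mulr_ge0 (ltW a_gt0) (ox i1).
  apply: (@le_lt_trans _ _ a); last by rewrite /a; lra.
  by rewrite ger_pMr// simplex_coord_le1.
have := ball_e _ fg; rewrite /= cantinorm_ballE /= ltNge => /negP; apply.
apply: le_trans (le_cantinorm_dist _ _ (simplex_delta i0)).
have gA : is_antinorm (linear_fun (e0 + a *: e1)) by exact: linear_fun_antinorm.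
have ge1 : linear_fun (e0 + a *: e1) e1 != 0.
  by rewrite linear_funE// dotrDl dotrZl !dotr_deltal e1i0 e1i1 add0r mulr1 gt_eqF.
have e01 : dotr e0 e1 = 0 by rewrite dotr_deltal.
rewrite /= (dual_fun_orthogonal gA oe0 oe1 e01 ge1) subr0.
exact: le_trans (dual_linear_fun_ge1 oe0 e0_neq0) (ler_norm _).
Qed.
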